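(* For a partition $\lambda=(\lambda_1,\dots,\lambda_k)$, one has $$\langle 0|\underline{\lambda}^{so}\rangle=\begin{cases}(-1)^{\frac{|\lambda|+\operatorname{rk}\lambda}{2}} & \text{if }\lambda=(\alpha|\alpha),\\ 0 & \text{otherwise,}\end{cases}$$ $$\langle 0|\underline{\lambda}^{sp}\rangle=\begin{cases}(-1)^{\frac{|\lambda|}{2}} & \text{if }\lambda=(\alpha+1|\alpha),\\ 0 & \text{otherwise,}\end{cases}$$ $$\langle 0|\underline{\lambda}^{o}\rangle=\begin{cases}(-1)^{\frac{|\lambda|}{2}} & \text{if }\lambda=(\alpha|\alpha+1),\\ 0 & \text{otherwise.}\end{cases}$$
   Context: Let $\mathcal{H}$ be the Heisenberg algebra generated by $a_n$, $n\in\mathbb{Z}\setminus\{0\}$, with $[a_m,a_n]=m\delta_{m,-n}$. The Fock space $\mathcal{M}$ is generated by the vacuum $|0\rangle$ with $a_n|0\rangle=0$ for $n>0$, so it has basis given by monomials in $a_{-1},a_{-2},\dots$ applied to $|0\rangle$. The dual vacuum $\langle 0|$ satisfies $\langle 0|a_{-n}=0$ for $n>0$ and $\langle0|0\rangle=1$; i.e. for $v\in\mathcal{M}$, $\langle 0|v\rangle$ is the coefficient of $|0\rangle$ in $v$. Define operators $U^*_n,Y^*_n,W^*_n$ ($n\in\mathbb{Z}$) on $\mathcal{M}$ by the generating series $$E^*(z)=\exp\Big(-\sum_{n\ge1}\frac{a_{-n}}{n}z^n\Big)\exp\Big(\sum_{n\ge1}\frac{a_n}{n}(z^{-n}+z^n)\Big),$$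 $$\sum_{n\in\mathbb{Z}}U^*_nz^n=(1-z)E^*(z),\qquad \sum_{n\in\mathbb{Z}}Y^*_nz^n=(1-z^2)E^*(z),\qquad \sum_{n\in\mathbb{Z}}W^*_nz^n=E^*(z).$$ For $\lambda=(\lambda_1,\dots,\lambda_k)$ put $$|\underline{\lambda}^{so}\rangle=U^*_{\lambda_1}\cdots U^*_{\lambda_k}|0\rangle,\quad |\underline{\lambda}^{sp}\rangle=Y^*_{\lambda_1}\cdots Y^*_{\lambda_k}|0\rangle,\quad |\underline{\lambda}^{o}\rangle=W^*_{\lambda_1}\cdots W^*_{\lambda_k}|0\rangle.$$ Frobenius notation: $\operatorname{rk}\lambda$ is the largest $r$ with $\lambda_r\ge r$, and $\lambda=(\alpha_1,\dots,\alpha_r|\beta_1,\dots,\beta_r)$ with $r=\operatorname{rk}\lambda$, $\alpha_i=\lambda_i-i$, $\beta_i=\lambda'_i-i$ ($\lambda'$ the conjugate partition). $\lambda=(\alpha+1|\alpha)$ means $\lambda=(\alpha_1+1,\dots,\alpha_r+1|\alpha_1,\dots,\alpha_r)$ for some strictly decreasing sequence $\alpha$ of nonnegative integers; similarly $(\alpha|\alpha)$ and $(\alpha|\alpha+1)$. $|\lambda|$ is the sum of the parts. *)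

(* Defs.v *)
From HB Require Import structures.
From mathcomp Require Import all_boot all_order all_algebra finmap.
From mathcomp Require Import boolp classical_sets fsbigop.
From mathcomp.multinomials Require Import monalg.

Set Implicit Arguments.
Unset Strict Implicit.
Unset Printing Implicit Defensive.

Import Order.TTheory GRing.Theory Num.Theory.
Local Open Scope ring_scope.

(* Polynomials in infinitely many commuting variables: the variable of index
   i : nat stands for a_{-(i+1)}, and the monomial 1 for the vacuum. *)
Notation fock F := {malg F[{cmonom nat}]}.

(* The derivation (i+1) d/dx_i; truncated division by x_i is harmless, as the
   coefficient vanishes when x_i does not divide the monomial. *)
HB.lock Definition annihilate (F : fieldType) (i : nat) (v : fock F) : fock F :=
  \sum_(m <- msupp v)
    << (i.+1 * m i)%:R * v@_m *g divcm m (ucm i) >>.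

HB.lock Definition create (F : fieldType) (i : nat) (v : fock F) : fock F :=
  << ucm i >> * v.

Section Fock.
Variable F : fieldType.
Implicit Types (v : fock F) (n : int).

Definition vacuum : fock F := 1.

(* The pairing of the dual vacuum <0| with v. *)
Definition vac_coef v : F := v@_(mone : {cmonom nat}).

(* The generators of the Heisenberg algebra; a 0 is junk, never used.
   Recall that Negz i is -(i+1). *)
Definition a n : fock F -> fock F :=
  match n with
  | Posz 0 => fun=> 0
  | Posz i.+1 => annihilate i
  | Negz i => create i
  end.

(* A formal distribution \sum_(n : int) A n z^n with operator coefficients. *)
Definition distrib := int -> fock F -> fock F.

Definition dist1 : distrib := fun n v => if n == 0 then v else 0.

(* Infinite sums of operators are computed pointwise; \sum_(i \in D) is the
   sum over the support, with value 0 when the support is infinite.  For the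
   distributions below every support is finite: a n v = 0 for n large, and
   creation_part has only positive powers of z. *)
Definition dist_mul (A B : distrib) : distrib :=
  fun n v => \sum_(i \in [set: int]) A i (B (n - i) v).

Definition dist_pow (A : distrib) (k : nat) : distrib :=
  iter k (dist_mul A) dist1.

Definition dist_exp (A : distrib) : distrib :=
  fun n v => \sum_(k \in [set: nat]) (k`!%:R^-1 *: dist_pow A k n v).

(* - \sum_(n >= 1) a_{-n} / n z^n *)
Definition creation_part : distrib :=
  fun n v => if 0 < n then - (n%:~R^-1 *: a (- n) v) else 0.

(* \sum_(n >= 1) a_n / n (z^{-n} + z^n): for n != 0, the coefficients of z^n
   and z^{-n} are both a_|n| / |n|. *)
Definition annihilation_part : distrib :=
  fun n v => if n == 0 then 0 else `|n|%:~R^-1 *: a `|n| v.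

Definition Estar : distrib :=
  dist_mul (dist_exp creation_part) (dist_exp annihilation_part).

Definition Ustar : distrib := fun n v => Estar n v - Estar (n - 1) v.
Definition Ystar : distrib := fun n v => Estar n v - Estar (n - 2) v.
Definition Wstar : distrib := Estar.

Definition ket (X : distrib) (lam : seq nat) : fock F :=
  foldr (fun l v => X l%:Z v) vacuum lam.

Definition ket_so := ket Ustar.
Definition ket_sp := ket Ystar.
Definition ket_o := ket Wstar.

End Fock.

(* Zero parts are allowed. *)
Definition is_partition (lam : seq nat) : bool := sorted geq lam.

Definition weight (lam : seq nat) : nat := sumn lam.

(* The part lambda_i is nth 0 lam i.-1. *)
Definition rk (lam : seq nat) : nat :=
  (\max_(i < size lam | i < nth 0 lam i) i.+1)%N.

(* The part lambda'_j of the conjugate partition, for j >= 1. *)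
Definition conj_part (lam : seq nat) (j : nat) : nat := count (leq j) lam.

(* The differences are not truncated, since i.+1 <= rk lam. *)
Definition frobenius (lam : seq nat) : seq nat * seq nat :=
  ([seq nth 0 lam i - i.+1 | i <- iota 0 (rk lam)]%N,
   [seq conj_part lam i.+1 - i.+1 | i <- iota 0 (rk lam)]%N).

Definition frob_eq (lam : seq nat) : Prop :=
  exists alpha, sorted gtn alpha /\ frobenius lam = (alpha, alpha).

Definition frob_arm_succ (lam : seq nat) : Prop :=
  exists alpha, sorted gtn alpha /\ frobenius lam = (map succn alpha, alpha).

Definition frob_leg_succ (lam : seq nat) : Prop :=
  exists alpha, sorted gtn alpha /\ frobenius lam = (alpha, map succn alpha).

(* The module is the Fock representation: vacuum, dual vacuum, commutators. *)
Section FockTheory.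
Variable F : fieldType.
Implicit Types (v : fock F) (n m : int).

Lemma mcoeff_annihilate i v (m : {cmonom nat}) :
  (annihilate i v)@_m = (i.+1 * (m i).+1)%:R * v@_(mmul m (ucm i)).
Proof.
rewrite annihilate.unlock raddf_sum /=.
under eq_bigr do rewrite mcoeffU.
have dE (k : {cmonom nat}) : (0 < k i)%N ->
    (divcm k (ucm i) == m) = (k == mmul m (ucm i)).
  move=> k0; apply/cmP/cmP => H j; have := H j; rewrite divcmE cmM cmU.
    by case: eqP => [<-|_] <-; [rewrite subnK|rewrite subn0 addn0].
  by move=> ->; rewrite addnK.
transitivity (\sum_(k <- msupp v) (if k == mmul m (ucm i)
    then (i.+1 * (m i).+1)%:R * v@_(mmul m (ucm i)) else 0)).
  apply: eq_bigr => k _; have [k0|] := posnP (k i).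
    rewrite k0 muln0 mul0r mul0rn; case: eqP => // kE.
    by move: k0; rewrite kE cmM cmU eqxx addn1.
  move=> k0; rewrite dE //; case: eqP => [->|_]; last by rewrite mulr0n.
  by rewrite mulr1n cmM cmU eqxx addn1.
case: (msuppP v (mmul m (ucm i))) => mv; last first.
  rewrite mulr0 big1 // => k _; by rewrite if_same.
rewrite (bigD1_seq _ mv) ?fset_uniq //= eqxx big1 ?addr0 // => k /negPf ->.
by [].
Qed.

Lemma a_vacuum n : 0 < n -> a n (vacuum F) = 0.
Proof.
case: n => [[|i]|i] //= _; apply/malgP => m.
rewrite mcoeff_annihilate mcoeff0 mcoeff1 cmM_eq1 cm1_eq1 andbF.
by rewrite mulr0.
Qed.

Lemma vac_coef_vacuum : vac_coef (vacuum F) = 1.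
Proof. by rewrite /vac_coef mcoeff1 eqxx. Qed.

Lemma mcoeff_create i v (m : {cmonom nat}) :
  (create i v)@_m = if (0 < m i)%N then v@_(divcm m (ucm i)) else 0.
Proof.
have dE (k : {cmonom nat}) : (mmul (ucm i) k == m) =
    (0 < m i)%N && (k == divcm m (ucm i)).
  apply/cmP/andP => [H|[mi /cmP H] j].
    split; first by rewrite -H cmM cmU eqxx.
    by apply/cmP => j; rewrite divcmE -H cmM addKn.
  rewrite cmM H divcmE cmU; case: eqP => [<-|_]; last by rewrite subn0.
  by rewrite subnKC.
rewrite create.unlock malgME msuppU1 raddf_sum /= big_seq_fset1 raddf_sum /=.
under eq_bigr do rewrite mcoeffU mcoeffU1 eqxx mul1r dE.
case: ifP => mi /=; last by rewrite big1.
under eq_bigr do rewrite mulrb.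
case: (msuppP v (divcm m (ucm i))) => mv; last first.
  rewrite big_seq big1 // => k kv; case: eqP => // kE.
  by move: mv; rewrite -kE kv.
rewrite (bigD1_seq _ mv) ?fset_uniq //= eqxx big1 ?addr0 // => k /negPf ->.
by [].
Qed.

Lemma vac_coef_create n v : n < 0 -> vac_coef (a n v) = 0.
Proof. by case: n => // i _; rewrite /vac_coef /= mcoeff_create cm1. Qed.

Let annihilate_create i j v :
  annihilate i (create j v) - create j (annihilate i v) =
    if i == j then i.+1%:R *: v else 0.
Proof.
apply/malgP => m.
rewrite mcoeffB mcoeff_annihilate !mcoeff_create cmM cmU mcoeff_annihilate.
case: (eqVneq i j) => [<-|ij].
  rewrite addn1 ltnS leq0n mcoeffZ divcmE cmU eqxx.
  have -> : divcm (mmul m (ucm i)) (ucm i) = m.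
    by apply/eqP/cmP => k; rewrite divcmE cmM addnK.
  case: posnP => [->|mi]; first by rewrite muln1 subr0.
  have -> : mmul (divcm m (ucm i)) (ucm i) = m.
    apply/eqP/cmP => k; rewrite cmM divcmE cmU.
    by case: eqP => [<-|_]; rewrite ?subnK // subn0 addn0.
  by rewrite subn1 prednK // -mulrBl -natrB -?mulnBr ?subSn ?subnn ?muln1 ?leq_mul.
rewrite addn0 mcoeff0 divcmE cmU eq_sym (negPf ij) subn0.
case: posnP => [_|mj]; first by rewrite mulr0 subr0.
suff -> : divcm (mmul m (ucm i)) (ucm j) = mmul (divcm m (ucm j)) (ucm i).
  by rewrite subrr.
apply/eqP/cmP => k; rewrite divcmE !cmM divcmE !cmU.
case: (eqVneq j k) => [<-|_]; last by rewrite !subn0.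
by rewrite (negPf ij) !addn0.
Qed.

Let createC i j v : create i (create j v) = create j (create i v).
Proof. by rewrite create.unlock; exact: mulrCA. Qed.

Let annihilateC i j v :
  annihilate i (annihilate j v) = annihilate j (annihilate i v).
Proof.
case: (eqVneq i j) => [->//|ij].
apply/malgP => k.
rewrite !mcoeff_annihilate !cmM !cmU [j == i]eq_sym (negPf ij) !addn0.
by rewrite -!mulmA (mulmC (ucm j)) mulrCA.
Qed.

Lemma heisenberg m n v : m != 0 -> n != 0 ->
  a m (a n v) - a n (a m v) = if m == - n then m%:~R *: v else 0.
Proof.
case: m => [[|i]|i] //; case: n => [[|j]|j] // _ _; rewrite [a _]/= ![a (_ _)]/=.
- by rewrite annihilateC subrr.
- by rewrite annihilate_create NegzE opprK eqz_nat eqSS.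
- rewrite -[LHS]opprB annihilate_create NegzE eqr_opp eqz_nat eqSS eq_sym.
  by case: eqP => [->|_]; rewrite ?oppr0 // mulrNz scaleNr.
- by rewrite createC subrr.
Qed.
End FockTheory.

(* Main.v *)
(* Write E(z) = c(z) T(z) with c(z), T(z) the creation and annihilation
   exponentials.  Moving T to the right of c gives
   T(z) E(w) = (1 - w/z)(1 - wz) E(w) T(z), hence, for X = U, Y, W, the relation
   X_n X_m = - X_{m-1} X_{n+1}.  As <0|E(z) = <0|T(z) and T(1/z) = T(z), also
   <0|X_{d-n} = e <0|X_n with (d, e) = (1, -1), (2, -1), (0, 1).  Finally
   X_n|0> = 0 for n < 0 and X_0|0> = |0>.

   For a partition with positive parts n_1 >= ... >= n_k, reflect n_1 to d - n_1
   and move it to the right end: up to a sign the vector becomes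
   X_{n_2 - 1} ... X_{n_k - 1} X_{d - n_1 + k - 1}|0>.  When n_1 > k - 1 + d the
   last index is negative and the result is 0; when n_1 = k - 1 + d it is zero,
   and the partition loses its first hook (its first row and column).  When
   n_1 < k - 1 + d, two of the numbers n_i - i + 1 coincide up to x |-> d - x,
   and antisymmetry gives 0.  So only partitions whose principal hooks all have
   arm = leg + d - 1 survive. *)

From HB Require Import structures.
Require Import Defs.
From mathcomp Require Import all_boot all_order all_algebra finmap.
From mathcomp Require Import boolp classical_sets fsbigop.
From mathcomp.multinomials Require Import monalg.
From mathcomp Require Import zify ring.

Import Order.TTheory GRing.Theory Num.Theory.
Local Open Scope ring_scope.

(** * Infinite sums of finite support, and the weighted degree *)

Lemma fsum_setTE (V : nmodType) (I : choiceType) (r : seq I) (f : I -> V) :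
  uniq r -> (forall i, i \notin r -> f i = 0) ->
  \sum_(i \in [set: I]) f i = \sum_(i <- r) f i.
Proof.
move=> ur f0; rewrite (fsbigE r) //; last by move=> i _; exact: f0.
by apply: eq_bigl => i; rewrite in_setT.
Qed.

Definition zrange N : seq int := [seq i%:Z - N%:Z | i <- iota 0 N.*2.+1].

Lemma mem_zrange N i : (i \in zrange N) = (`|i| <= N)%N.
Proof.
apply/mapP/idP => [[j]|iN]; first by rewrite mem_iota => jN ->; lia.
by exists (absz (i + N%:Z)); [rewrite mem_iota|]; lia.
Qed.

Lemma zrange_uniq N : uniq (zrange N).
Proof. by rewrite map_inj_uniq ?iota_uniq // => i j /= /addIr []. Qed.

Lemma fsum_int (V : nmodType) N (f : int -> V) :
  (forall i, (N < `|i|)%N -> f i = 0) ->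
  \sum_(i \in [set: int]) f i = \sum_(i <- zrange N) f i.
Proof.
move=> f0; apply: fsum_setTE (zrange_uniq N) _ => i.
by rewrite mem_zrange -ltnNge => /f0.
Qed.

Lemma fsum_nat (V : nmodType) N (f : nat -> V) :
  (forall i, (N <= i)%N -> f i = 0) ->
  \sum_(i \in [set: nat]) f i = \sum_(i < N) f i.
Proof.
move=> f0; rewrite -(big_mkord xpredT f) /index_iota subn0.
apply: fsum_setTE (iota_uniq 0 N) _ => i.
by rewrite mem_iota add0n -ltnNge ltnS => /f0.
Qed.

(** The grading in which a_{-n} has degree n. Since a_n lowers it by n, it bounds every sum over
    annihilation operators applied to a fixed vector. *)
Definition wdeg (m : {cmonom nat}) : nat :=
  (\sum_(i <- finsupp m) i.+1 * m i)%N.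

Lemma wdegEw (m : {cmonom nat}) (d : {fset nat}) :
  fsubset (finsupp m) d -> wdeg m = (\sum_(i <- d) i.+1 * m i)%N.
Proof.
move=> le; rewrite /wdeg (big_fset_incl _ le) // => i _.
by rewrite -cmE_eq0 => /eqP ->; rewrite muln0.
Qed.

Lemma wdegM : {morph wdeg : m1 m2 / mmul m1 m2 >-> (m1 + m2)%N}.
Proof.
move=> m1 m2; pose d := (finsupp m1 `|` finsupp m2)%fset.
rewrite (wdegEw m1 d) ?fsubsetUl // (wdegEw m2 d) ?fsubsetUr //.
rewrite (wdegEw _ d) ?mdomD // -big_split /=.
by apply: eq_bigr => i _; rewrite cmM mulnDr.
Qed.

Lemma wdegU i : wdeg (ucm i) = i.+1.
Proof. by rewrite /wdeg mdomU big_seq_fset1 cmUU muln1. Qed.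

Lemma sum_zrange_abs (V : nmodType) M j (f : int -> V) : (j < M)%N ->
  \sum_(i <- zrange M | `|i|%N == j.+1) f i = f j.+1%:Z + f (- j.+1%:Z).
Proof.
move=> jM; rewrite -big_filter (perm_big [:: j.+1%:Z; - j.+1%:Z]).
  by rewrite big_cons big_seq1.
apply: uniq_perm => [|//|i]; first by rewrite filter_uniq // zrange_uniq.
by rewrite mem_filter mem_zrange !inE; lia.
Qed.

(** * Exponentials of formal distributions *)

Section ExpCommutator.
Context {F : fieldType} {V : lmodType F}.
Context (A : int -> {linear V -> V}) (P : nat -> int -> V -> V).
Context (C : {linear V -> V}) (j M : nat) (v : V).
Context (jM : (j < M)%N).
Context (P0 : forall n w, P 0%N n w = if n == 0 then w else 0).
Context (PS : forall w k n, w = v \/ w = C v ->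
  P k.+1 n w = \sum_(i <- zrange M) A i (P k (n - i) w)).
Context (AC : forall i w,
  A i (C w) = C (A i w) + if `|i|%N == j.+1 then w else 0).

(** The commutator of A(z) with C is z^(j+1) + z^(-j-1) times the identity. Being central, it makes
    the commutator with C act on powers of A(z) as a derivation. *)
Lemma pow_commutator k n :
  P k n (C v) =
    C (P k n v) + k%:R *: (P k.-1 (n - j.+1%:Z) v + P k.-1 (n + j.+1%:Z) v).
Proof.
elim: k n => [|k IHk] n.
  rewrite scale0r addr0 !P0; case: eqP => // _; exact/esym/linear0.
(* At k = 0 the truncated index [k.-1] is wrong, but the factor k kills that term. *)
have step n' : k%:R *: (\sum_(i <- zrange M) A i (P k.-1 (n' - i) v)) =
    k%:R *: P k n' v.
  by case: k {IHk} => [|k]; rewrite ?scale0r // PS //; left.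
rewrite !PS; try by [left | right].
rewrite linear_sum.
under eq_bigr do rewrite IHk scalerDr !linearD AC !linearZ /=.
rewrite !big_split /= -addrA; congr (_ + _).
rewrite -big_mkcond sum_zrange_abs // opprK -!scaler_sumr.
under [X in _ + (k%:R *: X + _)]eq_bigr do rewrite addrAC.
under [X in _ + (_ + k%:R *: X)]eq_bigr do rewrite addrAC.
rewrite !step -scalerDr -natr1 scalerDl scale1r; exact: addrC.
Qed.

(** Dividing by k! absorbs the factor k of [pow_commutator] and shifts the index, so the last two
    sums have one term less. *)
Lemma exp_commutator K n (nz : forall k, k.+1%:R != 0 :> F) :
  \sum_(k < K.+1) k`!%:R^-1 *: P k n (C v) =
    C (\sum_(k < K.+1) k`!%:R^-1 *: P k n v) +
    (\sum_(k < K) k`!%:R^-1 *: P k (n - j.+1%:Z) v +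
     \sum_(k < K) k`!%:R^-1 *: P k (n + j.+1%:Z) v).
Proof.
under [LHS]eq_bigr => k _ do rewrite pow_commutator scalerDr.
rewrite big_split linear_sum /=; congr (_ + _).
  by apply: eq_bigr => k _; rewrite linearZ.
rewrite big_ord_recl scale0r scaler0 add0r -big_split /=.
apply: eq_bigr => k _; rewrite -scalerDr scalerA factS natrM invfM mulrAC.
by rewrite mulVf ?mul1r.
Qed.
End ExpCommutator.

(** * The creation exponential as a truncated power series *)

Section CreationExponential.
Context {F : fieldType} {V : comAlgType F}.
Context (natr_neq0 : forall k, k.+1%:R != 0 :> F).
Context (x : nat -> V) (B : int -> V -> V) (P : nat -> int -> V -> V).
Context (B_def : forall n v,
  B n v = if 0 < n then - (n%:~R^-1 *: (x `|n|.-1%N * v)) else 0).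
Context (P0 : forall n v, P 0%N n v = if n == 0 then v else 0).
Context (PS : forall k n v,
  P k.+1 n v = \sum_(i \in [set: int]) B i (P k (n - i) v)).
Context (C : int -> V -> V).
Context (C_def : forall n v,
  C n v = \sum_(k \in [set: nat]) (k`!%:R^-1 *: P k n v)).

(** Creation operators are multiplications in a commutative algebra, so up to degree N their
    generating series is a polynomial. The explicit factor ['X] shows that its k-th power starts in
    degree k. *)
Definition creation_poly N : {poly V} :=
  'X * \poly_(i < N) (- (i.+1%:R^-1 *: x i)).

Lemma creation_partE N n v : n <= N%:Z ->
  B n v = (if 0 <= n then (creation_poly N)`_`|n| else 0) * v.
Proof.
rewrite B_def; case: n => [[|p]|p] //= nN.
- by rewrite coefXM mul0r.
- by rewrite coefXM coef_poly ifT // mulNr -scalerAl.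
- by rewrite mul0r.
Qed.

Lemma creation_powE N k n v : n <= N%:Z ->
  P k n v = (if 0 <= n then (creation_poly N ^+ k)`_`|n| else 0) * v.
Proof.
elim: k n => [|k IHk] n nN.
  rewrite P0 expr0 coef1; case: n {nN} => [[|p]|p] /=;
    by rewrite ?mul1r ?mul0r.
have term i : B i (P k (n - i) v) =
    if 0 <= i <= n then
      (creation_poly N)`_`|i| * (creation_poly N ^+ k)`_`|n - i| * v else 0.
  case: (leP 0 i) => [i0 | i0] /=; last first.
    by rewrite B_def ltNge ltW.
  have [iN | iN] := leP i n; last first.
    rewrite IHk; last by lia.
    rewrite ifN; last by lia.
    by rewrite mul0r B_def mulr0 scaler0 oppr0 if_same.
  rewrite (creation_partE N) ?IHk; [|lia..].
  by rewrite i0 ifT ?mulrA //; lia.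
rewrite PS; case: n nN term => p nN term; last first.
  by rewrite mul0r; apply: fsbig1 => i _; rewrite term ifN //; lia.
rewrite (fsum_setTE _ _ [seq i%:Z | i <- iota 0 p.+1]); first last.
- move=> i ip; rewrite term ifN //; apply: contra ip => ip.
  by apply/mapP; exists (`|i|%N); rewrite ?mem_iota; lia.
- by rewrite map_inj_uniq ?iota_uniq // => i j [].
rewrite big_map -[iota 0 p.+1]/(index_iota 0 p.+1) big_mkord.
rewrite exprS coefM mulr_suml.
apply: eq_bigr => i _; rewrite term ifT; last by have := ltn_ord i; lia.
rewrite (_ : absz (p%:Z - i%:Z) = (p - i)%N) //.
by have := ltn_ord i; lia.
Qed.

Lemma coef_creation_exp_eq0 N k p : (p < k)%N -> (creation_poly N ^+ k)`_p = 0.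
Proof. by move=> pk; rewrite /creation_poly exprMn coefXnM pk. Qed.

Lemma creation_expE N K n v : n <= N%:Z -> n < K%:Z ->
  C n v =
    (if 0 <= n then
       \sum_(k < K) k`!%:R^-1 *: (creation_poly N ^+ k)`_`|n| else 0) * v.
Proof.
move=> nN nK; rewrite C_def (fsum_nat _ K) => [|k Kk].
  case: ifP => n0; last first.
    rewrite mul0r big1 // => k _.
    by rewrite (creation_powE N) // n0 mul0r scaler0.
  rewrite mulr_suml; apply: eq_bigr => k _.
  by rewrite (creation_powE N) // n0 scalerAl.
rewrite (creation_powE N) //; case: ifP => n0; last by rewrite mul0r scaler0.
by rewrite coef_creation_exp_eq0 ?mul0r ?scaler0 //; lia.
Qed.

Lemma creation_exp_mul n v : C n v = C n 1 * v.
Proof.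
rewrite (creation_expE `|n| `|n|.+1) ?[C n 1](creation_expE `|n| `|n|.+1);
  try by lia.
by rewrite mulr1.
Qed.

Lemma creation_exp_neg n v : n < 0 -> C n v = 0.
Proof. by move=> n0; rewrite (creation_expE 0 0) ?ifN ?mul0r //; lia. Qed.

Lemma creation_exp0 v : C 0 v = v.
Proof.
rewrite (creation_expE 0 1) //= big_ord1 expr0 coef1.
by rewrite invr1 scale1r mul1r.
Qed.

(** The coefficient of z^p in c'(z) = - (\sum_j x_j z^j) c(z); with x_j read as the power sum
    p_{j+1}, this is Newton's identity. *)
Lemma creation_exp_rec p :
  p.+1%:R *: C p.+1 1 = - \sum_(j < p.+1) x j * C (p%:Z - j%:Z) 1.
Proof.
rewrite (creation_expE p.+1 p.+2); [|lia..].
rewrite mulr1 /=.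
rewrite big_ord_recl expr0 coef1 scaler0 add0r scaler_sumr.
have derivE j : (j < p.+1)%N -> ((creation_poly p.+1)^`())`_j = - x j.
  move=> jp; rewrite coef_deriv coefXM coef_poly jp mulNrn -scaler_nat scalerA.
  by rewrite mulfV ?scale1r.
transitivity (\sum_(k < p.+1) k`!%:R^-1 *:
    ((creation_poly p.+1)^`() * creation_poly p.+1 ^+ k)`_p).
  apply: eq_bigr => k _; rewrite scalerA mulrC -scalerA scaler_nat -coef_deriv.
  rewrite deriv_exp coefMn -scaler_nat scalerA factS natrM invfM mulrAC.
  by rewrite mulVf ?mul1r // mulrC.
under [LHS]eq_bigr do rewrite coefM scaler_sumr.
rewrite exchange_big -sumrN; apply: eq_bigr => j _ /=.
have jp := ltn_ord j; rewrite (creation_expE p.+1 p.+1); [|lia..].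
rewrite ifT; last by lia.
rewrite (_ : absz _ = (p - j)%N); last by lia.
rewrite mulr1 mulr_sumr -sumrN; apply: eq_bigr => k _.
by rewrite derivE // mulNr scalerN scalerAr.
Qed.
End CreationExponential.

(** * Partitions *)

Lemma sorted_predn s : sorted geq s -> sorted geq (map predn s).
Proof. by apply: homo_sorted => a b /=; lia. Qed.

(** Removing the first row and column can create zero parts, so trailing zeros are stripped by a
    separate case. Both cases shorten the list. *)
Lemma partition_ind (P : seq nat -> Prop) :
  P [::] -> (forall s, P s -> P (rcons s 0%N)) ->
  (forall n s, sorted geq (n :: s) -> all (leq 1) (n :: s) ->
    P (map predn s) -> P (n :: s)) ->
  forall s, sorted geq s -> P s.
Proof.
move=> P0 Pr Pc s; elim: {s}(size s) {-2}s (leqnn (size s)) => [|k IHk] s.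
  by rewrite leqn0 size_eq0 => /eqP ->.
have gtr : transitive geq by move=> a b c /= ba ac; apply: leq_trans ac ba.
(* The default 1 sends the empty list to the second case. *)
case: (posnP (last 1%N s)) => [s0|s0].
  case/lastP: s s0 => [//|s y]; rewrite last_rcons => ->.
  rewrite size_rcons ltnS => sk; rewrite -cats1 => /cat_sorted2[ss _].
  by rewrite cats1; apply/Pr/IHk.
case: s s0 => [//|n s] /= s0 sk ss.
have pos : all (leq 1) (n :: s).
  apply/allP => z; move: ss; rewrite -[path _ _ _]/(sorted geq (n :: s)).
  rewrite lastI; move: s0; rewrite -/(last n s); set y := last n s => y0.
  rewrite -cats1 (sorted_pairwise gtr) pairwise_cat => /and3P[/allrelP H _ _].
  rewrite mem_cat !inE => /orP[zb|/eqP -> //].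
  by apply: leq_trans y0 _; apply: (H z y zb); rewrite inE.
apply: Pc => //; apply: IHk; first by rewrite size_map.
exact: sorted_predn (path_sorted ss).
Qed.

Lemma rk_rcons0 s : rk (rcons s 0%N) = rk s.
Proof.
rewrite /rk size_rcons big_mkcond big_ord_recr /=.
rewrite nth_rcons ltnn eqxx ltn0 maxn0.
rewrite [RHS]big_mkcond; apply: eq_bigr => i _ /=.
by rewrite nth_rcons ltn_ord.
Qed.

Lemma frobenius_rcons0 s : frobenius (rcons s 0%N) = frobenius s.
Proof.
rewrite /frobenius rk_rcons0; congr pair; apply: eq_map => i.
  by rewrite nth_rcons; case: ltngtP => // si; rewrite nth_default ?si // ltnW.
by rewrite /conj_part -cats1 count_cat /= !addn0.
Qed.

Lemma rk_cons n s : all (leq 1) (n :: s) -> rk (n :: s) = (rk (map predn s)).+1.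
Proof.
move=> /andP[n0 _].
rewrite /rk /= big_mkcond big_ord_recl /= n0 size_map [in RHS]big_mkcond /=.
(* The first row contributes 1 to the maximum. Unlike x = y + 1, this relation also holds between
   empty maxima. *)
apply: (big_ind2 (fun x y => maxn 1 x = y.+1)) => //= [x1 x2 y1 y2|i _].
  lia.
have -> : (bump 0 i < nth 0 s i)%N = (i < nth 0 [seq x.-1 | x <- s] i)%N.
  by rewrite (nth_map 0%N) //= /bump; lia.
by case: ifP.
Qed.

Lemma rk_leq_head n s : sorted geq (n :: s) -> (rk (n :: s) <= n)%N.
Proof.
move=> ss; apply/bigmax_leqP => i /leq_trans; apply.
have gtr : transitive geq by move=> a b c /= ba ac; apply: leq_trans ac ba.
case: i => -[|i] //= iS.
have := order_path_min gtr ss => /allP /(_ (nth 0%N s i)) /=; apply.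
exact: mem_nth.
Qed.

(** The corner hook has arm n - 1 and leg [size s], all parts being positive. Removing it moves the
    other diagonal boxes one step along the diagonal and keeps their arms and legs. *)
Lemma frobenius_cons n s : sorted geq (n :: s) -> all (leq 1) (n :: s) ->
  frobenius (n :: s) = (n.-1 :: (frobenius (map predn s)).1,
                        size s :: (frobenius (map predn s)).2).
Proof.
move=> ss pos; have := rk_leq_head _ _ ss.
rewrite /frobenius rk_cons //= => rn.
have /andP[n0 s0] := pos.
rewrite -(addn0 1%N) iotaDl addn0 -!map_comp subn1; congr (_ :: _, _ :: _).
- apply: eq_map => i /=; case: (ltnP i (size s)) => si.
    by rewrite add0n (nth_map 0%N) //; lia.
  by rewrite !nth_default ?size_map.
- rewrite /conj_part /= n0 add1n subn1 /=; apply/eqP.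
  by rewrite -all_count.
- apply/eq_in_map => i; rewrite mem_iota add0n => ir /=.
  (* The first row meets column i + 2, as i + 1 < rk <= n; its contribution 1 cancels the shift of
     the diagonal. *)
  rewrite /conj_part /= count_map (_ : (1 + i < n)%N = true); last by lia.
  rewrite (eq_count (a2 := preim predn (leq i.+1))) => [|z] /=; lia.
Qed.

Lemma weight_cons n s : all (leq 1) (n :: s) ->
  weight (n :: s) = (n + size s + weight (map predn s))%N.
Proof.
move=> /andP[_ s0]; rewrite /weight /= -addnA; congr addn.
by elim: s s0 => //= y s IHs /andP[y0 /IHs ->]; lia.
Qed.

(* With legs b_i and arms a_i this says a_i + 1 = b_i + d; the three cases of
   the theorem are d = 1 (so), d = 2 (sp) and d = 0 (o). *)
Definition frob_shift d s :=
  map succn (frobenius s).1 == map (addn d) (frobenius s).2.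

(* Each hook removal (Phi_cons) contributes its leg, plus one if d > 0. *)
Definition frob_sign d s := (sumn (frobenius s).2 + (0 < d) * rk s)%N.

Lemma weight_frobenius s : sorted geq s ->
  weight s = (sumn (frobenius s).1 + sumn (frobenius s).2 + rk s)%N.
Proof.
elim/partition_ind => {s} [|s IHs|n s ss pos IHs].
- by rewrite /weight /frobenius /rk big_ord0.
- by rewrite frobenius_rcons0 rk_rcons0 -IHs /weight sumn_rcons addn0.
- rewrite frobenius_cons // rk_cons // weight_cons // IHs /=.
  by case/andP: pos => n0 _; lia.
Qed.

Lemma size_frobenius1 s : size (frobenius s).1 = rk s.
Proof. by rewrite size_map size_iota. Qed.

Lemma size_frobenius2 s : size (frobenius s).2 = rk s.
Proof. by rewrite size_map size_iota. Qed.

(** Each hook has arm + leg + 1 = 2 leg + d boxes. This converts [frob_sign] into the exponents of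
    the theorem. *)
Lemma weight_frob_shift d s : sorted geq s -> frob_shift d s ->
  weight s = ((sumn (frobenius s).2).*2 + d * rk s)%N.
Proof.
move=> ss /eqP Hd; have := congr1 sumn Hd; rewrite weight_frobenius //.
have sum_map a r : sumn (map (addn a) r) = (a * size r + sumn r)%N.
  by elim: r => [|z r IHr] /=; rewrite ?muln0 // IHr mulnS; lia.
rewrite (sum_map 1%N) sum_map size_frobenius1 size_frobenius2; lia.
Qed.

(** Provides the strict decrease of alpha in all three cases: the legs inherit it from the arms
    through the shift relation. *)
Lemma sorted_frobenius1 s : sorted geq s -> sorted gtn (frobenius s).1.
Proof.
elim/partition_ind => {s} [|s IHs|n s ss pos IHs].
- by rewrite /frobenius /rk big_ord0.
- by rewrite frobenius_rcons0.
rewrite frobenius_cons //.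
case E : (frobenius (map predn s)) IHs => [[|h t] b] //= ->; rewrite andbT.
case: s ss pos E => [|m s] ss pos; first by rewrite /frobenius /rk big_ord0.
have := rk_leq_head _ _ (sorted_predn _ (path_sorted ss)).
rewrite /frobenius; case: rk => [//|r] /= + [<- _ _].
by move: ss pos => /= /andP[+ _] /and3P[]; lia.
Qed.

Lemma not_uniq_map (T U : eqType) (f : T -> U) (l : seq T) :
  ~~ uniq (map f l) ->
  exists p x q y r, l = p ++ x :: q ++ y :: r /\ f x = f y.
Proof.
elim: l => [//|x l IHl] /=; rewrite negb_and negbK => /orP[/mapP[y yl xy]|].
  by case/splitPr: yl => q r; exists [::], x, q, y, r.
by move=> /IHl[p [x' [q [y [r [-> xy]]]]]]; exists (x :: p), x', q, y, r.
Qed.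

(** * Functionals subject to the exchange and reflection relations *)

Section PartitionFunctional.
Context {F : fieldType} (two_neq0 : 2%:R != 0 :> F).
Context (d : nat) (d_le2 : (d <= 2)%N) (Phi : seq int -> F).
Context (Phi_nil : Phi [::] = 1).
Context (Phi_swap : forall p q n m,
  Phi (p ++ n :: m :: q) = - Phi (p ++ (m - 1) :: (n + 1) :: q)).
Context (Phi_reflect : forall n q,
  Phi ((d%:Z - n) :: q) = (-1) ^+ (0 < d)%N * Phi (n :: q)).
Context (Phi_neg : forall p n, n < 0 -> Phi (rcons p n) = 0).
Context (Phi_0 : forall p, Phi (rcons p 0) = Phi p).

Lemma eq_opp_eq0 (u : F) : u = - u -> u = 0.
Proof.
move/eqP; rewrite -subr_eq0 opprK -mulr2n -mulr_natl mulf_eq0.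
by rewrite (negPf two_neq0) => /eqP.
Qed.

(** Each exchange raises the moving entry by 1, lowers the one it passes by 1 and changes the
    sign. *)
Lemma Phi_rotate p n q :
  Phi (p ++ n :: q) =
    (-1) ^+ size q * Phi (p ++ rcons [seq y - 1 | y <- q] (n + (size q)%:Z)).
Proof.
elim: q p n => [|y q IHq] p n; first by rewrite mul1r addr0.
rewrite Phi_swap -cat_rcons IHq cat_rcons /= exprS mulN1r mulNr.
by congr (- (_ * Phi (_ ++ _ :: rcons _ _))); lia.
Qed.

Fixpoint unshift (o : int) (l : seq int) : seq int :=
  if l is x :: l' then x + o :: unshift (o + 1) l' else [::].

Lemma unshift_cat o p q :
  unshift o (p ++ q) = unshift o p ++ unshift (o + (size p)%:Z) q.
Proof.
elim: p o => [|x p IHp] o /=; first by rewrite addr0.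
by rewrite IHp; congr (_ :: _ ++ unshift _ _); lia.
Qed.

(* In the coordinates l_i = n_i - i the relations satisfied by Phi become
   antisymmetry and (anti)symmetry under l_1 |-> d - l_1, so that Psi transforms
   by a sign under a hyperoctahedral group. *)
Definition Psi l := Phi (unshift 0 l).

Lemma Psi_swap p x y q : Psi (p ++ x :: y :: q) = - Psi (p ++ y :: x :: q).
Proof.
rewrite /Psi !unshift_cat /= Phi_swap.
by congr (- Phi (_ ++ _ :: _ :: _)); lia.
Qed.

Lemma Psi_reflect x l : Psi (d%:Z - x :: l) = (-1) ^+ (0 < d)%N * Psi (x :: l).
Proof. by rewrite /Psi /= !addr0 Phi_reflect. Qed.

Lemma Psi_move p x q : Psi (p ++ x :: q) = (-1) ^+ size p * Psi (x :: p ++ q).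
Proof.
elim/last_ind: p q => [|p y IHp] q; first by rewrite mul1r.
rewrite cat_rcons Psi_swap IHp -cat_rcons size_rcons exprS mulN1r mulNr.
by [].
Qed.

Lemma Psi_double x l : Psi (x :: x :: l) = 0.
Proof. exact/eq_opp_eq0/(Psi_swap [::]). Qed.

Lemma Psi_eq0 p x q y r : x = y \/ x = d%:Z - y ->
  Psi (p ++ x :: q ++ y :: r) = 0.
Proof.
(* First y and then x is moved to the front, the only place where x can be reflected. *)
move=> xy; rewrite -cat_cons catA Psi_move -catA.
rewrite -cat_cons Psi_move -[in X in _ * X]cat_cons.
case: xy => ->; first by rewrite Psi_double !mulr0.
by rewrite Psi_reflect Psi_double !mulr0.
Qed.

Lemma Psi_fixed_eq0 p x q : (0 < d)%N -> x = d%:Z - x -> Psi (p ++ x :: q) = 0.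
Proof.
move=> d0 xE; rewrite Psi_move; apply/eqP; rewrite mulf_eq0; apply/orP; right.
by apply/eqP/eq_opp_eq0; rewrite {1}xE Psi_reflect d0 mulN1r.
Qed.

Definition orbit_rep (x : int) : int := Num.max x (d%:Z - x).

(* The k + 1 entries have representatives among the k integers d .. k - 1 + d,
   the fixed point x = 1 of x |-> 2 - x being excluded when d = 2; so two of
   them are in the same orbit. *)
Lemma Psi_pigeonhole (l : seq int) (k : nat) : size l = k.+1 ->
  (forall x, x \in l -> - k%:Z < x < k%:Z + d%:Z) -> Psi l = 0.
Proof.
move=> sl lk.
have [ul|/not_uniq_map[p [x [q [y [r [-> xy]]]]]]] :=
    boolP (uniq (map orbit_rep l)); last first.
  by apply: Psi_eq0; move: xy; rewrite /orbit_rep; lia.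
have [l1|l1] := boolP ((1 \in l) && (d == 2%N)).
  case/andP: l1 => /splitPr[p q] /eqP d2.
  by apply: Psi_fixed_eq0; rewrite d2.
suff /(uniq_leq_size ul) :
    {subset map orbit_rep l <= [seq i%:Z | i <- iota d k]}.
  by rewrite !size_map size_iota sl ltnn.
move=> _ /mapP[x xl ->]; have := lk x xl => xk.
have x1 : (x == 1) && (d == 2%N) = false.
  by apply: contraNF l1 => /andP[/eqP <- ->]; rewrite xl.
apply/mapP; exists (absz (orbit_rep x)); last by rewrite /orbit_rep; lia.
by rewrite mem_iota /orbit_rep; lia.
Qed.

Lemma sorted_geq_nth (s : seq nat) i j : sorted geq s ->
  (i <= j)%N -> (nth 0 s j <= nth 0 s i)%N.
Proof.
move=> ss ij; have [sj|js] := leqP (size s) j; first by rewrite nth_default.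
have gtr : transitive geq by move=> a b c /= ba ac; apply: leq_trans ac ba.
have grefl : reflexive geq by move=> a /=.
by apply: (sorted_leq_nth gtr grefl 0%N ss) => //; rewrite ?inE; lia.
Qed.

Lemma Phi_unshift l : Phi l = Psi [seq nth 0 l i - i%:Z | i <- iota 0 (size l)].
Proof.
rewrite /Psi; congr Phi.
have E (o : int) :
    l = unshift o [seq nth 0 l i - i%:Z - o | i <- iota 0 (size l)].
  elim: l o => //= x l IHl o; rewrite subr0 subrK -(addn0 1%N) iotaDl -map_comp.
  congr (_ :: _); rewrite {1}(IHl (o + 1)); congr unshift.
  by apply: eq_map => i /=; rewrite add0n; lia.
by rewrite {1}(E 0); congr unshift; apply: eq_map => i; rewrite subr0.
Qed.

Lemma Phi_cons n s : sorted geq (n :: s) -> all (leq 1) (n :: s) ->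
  Phi [seq i%:Z | i <- n :: s] =
    if n == (size s + d)%N then
      (-1) ^+ (size s + (0 < d)) * Phi [seq i%:Z | i <- map predn s]
    else 0.
Proof.
move=> ss pos.
have phiE : Phi [seq i%:Z | i <- n :: s] =
    (-1) ^+ (size s + (0 < d)) * Phi (rcons [seq i%:Z | i <- map predn s]
                                       (d%:Z - n%:Z + (size s)%:Z)).
  rewrite /= {1}(_ : n%:Z = d%:Z - (d%:Z - n%:Z)); last by lia.
  rewrite Phi_reflect -[_ :: _]cat0s Phi_rotate.
  rewrite mulrA -exprD size_map addnC; congr (_ * Phi (rcons _ _)).
  rewrite -!map_comp; apply/eq_in_map => i /= si.
  by have /andP[_ /allP /(_ _ si)] := pos; case: i {si} => //; lia.
case: (ltngtP n (size s + d)%N) => nd.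
(* With k = [size s], the parts satisfy 1 <= n_i <= n < k + d and the positions run from 0 to k, so
   n_i - i lies strictly between -k and k + d. *)
- rewrite Phi_unshift.
  apply: (Psi_pigeonhole _ (size s)); first by rewrite /= !size_map size_iota.
  move=> x /mapP[i]; rewrite mem_iota /= size_map => iS ->.
  rewrite -[n%:Z :: _]/[seq i%:Z | i <- n :: s] (nth_map 0%N) //.
  have := sorted_geq_nth _ _ _ ss (leq0n i).
  have := all_nthP 0%N pos i iS => /=; lia.
- by rewrite phiE Phi_neg ?mulr0 //; lia.
- rewrite phiE (_ : _ + _ = 0) ?Phi_0 //; lia.
Qed.

Lemma Phi_partition s : sorted geq s ->
  Phi [seq i%:Z | i <- s] = if frob_shift d s then (-1) ^+ frob_sign d s else 0.
Proof.
elim/partition_ind => {s} [|s IHs|n s ss pos IHs].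
- by rewrite Phi_nil /frob_shift /frob_sign /frobenius /rk big_ord0 /= muln0.
- rewrite map_rcons Phi_0 IHs /frob_shift /frob_sign frobenius_rcons0.
  by rewrite rk_rcons0.
rewrite Phi_cons // IHs /frob_shift /frob_sign frobenius_cons // rk_cons //=.
have /andP[n0 _] := pos.
(* The condition on the first hook, n = d + [size s], is exactly the hypothesis under which
   [Phi_cons] does not vanish. *)
rewrite eqseq_cons prednK // addnC.
case: eqP => //= _; case: ifP => _; rewrite ?mulr0 // -exprD.
by congr (_ ^+ _); rewrite mulnS; lia.
Qed.
End PartitionFunctional.

(** * Relations between vertex operators *)

(* V is the Fock space, x j is a_{-j-1}, and T n, c n, E n are the coefficients
   of z^n in exp(sum_k a_k/k (z^-k + z^k)), exp(- sum_k a_{-k}/k z^k) and in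
   their product E(z). *)
Section VertexOperators.
Context {F : fieldType} {V : comAlgType F}.
Context (natr_neq0 : forall k, k.+1%:R != 0 :> F).
Context (x : nat -> V) (T : int -> {linear V -> V}).
Context (T_1 : forall n, T n 1 = if n == 0 then 1 else 0).
Context (T_x : forall n j v,
  T n (x j * v) = x j * T n v + (T (n - j.+1%:Z) v + T (n + j.+1%:Z) v)).
Context (x_ind : forall P : V -> Prop, P 1 ->
  (forall a v w, P v -> P w -> P (a *: v + w)) ->
  (forall j v, P v -> P (x j * v)) -> forall v, P v).

Lemma TC n p v : T n (T p v) = T p (T n v).
Proof.
elim/x_ind: v n p => [|a v w IHv IHw|j v IHv] n p.
- rewrite !T_1; case: (eqVneq n 0) => [->|n0];
    case: (eqVneq p 0) => [->|p0] //; rewrite ?linear0 //;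
    by rewrite T_1 ?(negPf n0) ?(negPf p0).
- by rewrite !linearP IHv IHw.
- rewrite !T_x !linearD /= !T_x -!addrA (IHv n p).
  congr (_ + _); rewrite addrA [RHS]addrA [RHS]addrC -addrA [RHS]addrA.
  by rewrite -!addrA; congr (_ + (_ + (_ + _))); exact: IHv.
Qed.

Lemma T_opp n v : T (- n) v = T n v.
Proof.
elim/x_ind: v n => [|c v w IHv IHw|j v IHv] n.
- by rewrite !T_1 oppr_eq0.
- by rewrite !linearP IHv IHw.
- rewrite !T_x IHv; congr (_ + _).
  by rewrite addrC -[in RHS]IHv -[in X in _ = _ + X]IHv !opprD !opprK.
Qed.

Context (c : int -> V) (c_neg : forall n, n < 0 -> c n = 0) (c_0 : c 0 = 1).
Context (c_rec : forall p : nat,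
  p.+1%:R *: c p.+1 = - \sum_(j < p.+1) x j * c (p%:Z - j%:Z)).

(** Any cutoff K >= q is allowed because [c] vanishes at negative indices; [T_c] applies it to
    several indices with one common range. *)
Lemma c_recz (q : int) K : q <= K%:Z ->
  q%:~R *: c q = - \sum_(j < K) x j * c (q - 1 - j%:Z).
Proof.
move=> qK; case: (ltrgt0P q) => [q0|q0|->]; last first.
- by rewrite scale0r big1 ?oppr0 // => j _; rewrite c_neg ?mulr0 //; lia.
- rewrite c_neg // scaler0 big1 ?oppr0 // => j _.
  by rewrite c_neg ?mulr0 //; lia.
case: q q0 qK => [[|p]|p] // _ pK.
rewrite -[p.+1%:~R]/(p.+1%:R) c_rec; congr (- _).
rewrite -!(big_mkord xpredT (fun j => x j * c (_ - j%:Z))).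
rewrite [RHS](big_cat_nat (leq0n _) pK) /= [X in _ + X]big1_seq ?addr0 => [|j].
  apply: eq_bigr => j _; congr (_ * c _); lia.
by rewrite mem_index_iota => /andP[_ /andP[pj _]]; rewrite c_neg ?mulr0 //; lia.
Qed.

(* T(z) c(w) = (1 - w/z)(1 - wz) c(w) T(z): both sides satisfy the differential
   equation in w expressed by c_rec. *)
Lemma T_c n m v :
  T n (c m * v) = c m * T n v - c (m - 1) * T (n + 1) v
                  - c (m - 1) * T (n - 1) v + c (m - 2) * T n v.
Proof.
(* [H p q] is the coefficient of w^p z^q in c(w) T(z) v, and [R p q] the one in (1 - w/z)(1 - wz)
   c(w) T(z) v. *)
pose H p q := c p * T q v.
pose R p q := H p q - H (p - 1) (q + 1) - H (p - 1) (q - 1) + H (p - 2) q.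
rewrite -/(R m n).
have H0 p q : p < 0 -> H p q = 0 by move=> p0; rewrite /H c_neg ?mul0r.
have [K mK] : exists K : nat, m <= K%:Z by exists `|m|%N; lia.
elim: K m mK n => [|K IHK] m mK n.
  have [m0|m0] := ltP m 0.
    by rewrite c_neg // mul0r linear0 /R !H0 ?subr0 ?addr0 //; lia.
  have -> : m = 0 by lia.
  by rewrite /R (H0 (0 - 1)) // (H0 (0 - 1)) // (H0 (0 - 2)) //
    /H c_0 !mul1r !subr0 addr0.
have [mK1|mK1] := leP m K%:Z; first exact: IHK.
have {mK mK1} mE : m = K.+1%:Z by lia.
have xH (p q : int) : p <= m ->
    p%:~R *: H p q = - \sum_(j < K.+1) x j * H (p - 1 - j%:Z) q.
  rewrite mE => pm; rewrite /H scalerAl (c_recz _ _ pm) mulNr mulr_suml.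
  by congr (- _); apply: eq_bigr => j _; rewrite mulrA.
have S1 : \sum_(j < K.+1) x j * R (m - 1 - j%:Z) n =
    - (m%:~R *: H m n) + (m - 1)%:~R *: H (m - 1) (n + 1)
    + (m - 1)%:~R *: H (m - 1) (n - 1) - (m - 2)%:~R *: H (m - 2) n.
  rewrite !xH; [|lia..]; rewrite !opprK -!sumrN -!big_split /=.
  apply: eq_bigr => j _; rewrite /R.
  rewrite (_ : m - 1 - 1 - j%:Z = m - 1 - j%:Z - 1); last by lia.
  rewrite (_ : m - 2 - 1 - j%:Z = m - 1 - j%:Z - 2); last by lia.
  ring.
(* Summing over j multiplies by the geometric series wz / (1 - wz), which cancels one factor of [R]
   and leaves wz (1 - w/z). In [S3] the same happens with w/z and the other factor. *)
have S2 : \sum_(j < K.+1) R (m - 1 - j%:Z) (n - j.+1%:Z) =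
    H (m - 1) (n - 1) - H (m - 2) n.
  pose f (j : nat) := H (m - 2 - j%:Z) (n - j%:Z)
                      - H (m - 1 - j%:Z) (n - 1 - j%:Z).
  transitivity (\sum_(0 <= j < K.+1) (f j.+1 - f j)).
    rewrite big_mkord; apply: eq_bigr => j _; rewrite /f /R.
    rewrite (_ : n - 1 - j.+1%:Z = n - j.+1%:Z - 1); last by lia.
    rewrite (_ : n - 1 - j%:Z = n - j.+1%:Z); last by lia.
    rewrite (_ : n - j%:Z = n - j.+1%:Z + 1); last by lia.
    rewrite (_ : m - 2 - j.+1%:Z = m - 1 - j%:Z - 2); last by lia.
    rewrite (_ : m - 2 - j%:Z = m - 1 - j%:Z - 1); last by lia.
    rewrite (_ : m - 1 - j.+1%:Z = m - 1 - j%:Z - 1); last by lia.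
    ring.
  rewrite telescope_sumr // /f ![H _ (_ - K.+1%:Z)]H0; [|lia..].
  by rewrite !subr0; ring.
have S3 : \sum_(j < K.+1) R (m - 1 - j%:Z) (n + j.+1%:Z) =
    H (m - 1) (n + 1) - H (m - 2) n.
  pose f (j : nat) := H (m - 2 - j%:Z) (n + j%:Z)
                      - H (m - 1 - j%:Z) (n + 1 + j%:Z).
  transitivity (\sum_(0 <= j < K.+1) (f j.+1 - f j)).
    rewrite big_mkord; apply: eq_bigr => j _; rewrite /f /R.
    rewrite (_ : n + 1 + j.+1%:Z = n + j.+1%:Z + 1); last by lia.
    rewrite (_ : n + 1 + j%:Z = n + j.+1%:Z); last by lia.
    rewrite (_ : n + j%:Z = n + j.+1%:Z - 1); last by lia.
    rewrite (_ : m - 2 - j.+1%:Z = m - 1 - j%:Z - 2); last by lia.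
    rewrite (_ : m - 2 - j%:Z = m - 1 - j%:Z - 1); last by lia.
    rewrite (_ : m - 1 - j.+1%:Z = m - 1 - j%:Z - 1); last by lia.
    ring.
  rewrite telescope_sumr // /f ![H _ (_ + K.+1%:Z)]H0; [|lia..].
  rewrite (_ : n + 0%:Z = n); last by lia.
  rewrite (_ : n + 1 + 0%:Z = n + 1); last by lia.
  by rewrite !subr0; ring.
(* Both sides are compared after multiplication by m, so that the recurrence for [c m] and the
   induction hypothesis apply. *)
have mR : m%:~R != 0 :> F by rewrite mE; exact: natr_neq0.
apply: (scalerI mR); rewrite -linearZ_LR scalerAl (c_recz m K.+1) ?mE // -mE.
rewrite mulNr mulr_suml linearN linear_sum /=.
under eq_bigr => j _.
  rewrite -mulrA T_x !IHK; [|have := ltn_ord j; lia..].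
  over.
rewrite [X in - X = _]big_split [X in - (_ + X) = _]big_split /= S1 S2 S3.
have -> : (m - 1)%:~R = m%:~R - 1 :> F by rewrite intrB.
have -> : (m - 2)%:~R = m%:~R - 2%:R :> F by rewrite intrB.
rewrite !scalerBl !scale1r scaler_nat /R !(scalerDr, scalerN); ring.
Qed.

(** In the Fock space, [bnd N v] says that v has weighted degree at most N. Then T_p v = 0 for |p| >
    N, which is why [E_def] admits every cutoff M > n + N. *)
Context (bnd : nat -> V -> Prop).
Context (bnd_leq : forall N1 N2 v, (N1 <= N2)%N -> bnd N1 v -> bnd N2 v).
Context (bnd_ex : forall v, exists N, bnd N v).
Context (bnd_lin : forall N a v w, bnd N v -> bnd N w -> bnd N (a *: v + w)).
Context (bnd_T : forall N n v, bnd N v -> bnd N (T n v)).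
Context (E : int -> V -> V).
Context (E_def : forall N (M : nat) n v, bnd N v -> n + N%:Z < M%:Z ->
  E n v = \sum_(i < M) c i * T (n - i%:Z) v).

Lemma E_linear n : linear (E n).
Proof.
move=> a v w.
have [N1 N1v] := bnd_ex v; have [N2 N2w] := bnd_ex w.
have Nv := bnd_leq _ _ _ (leq_maxl N1 N2) N1v.
have Nw := bnd_leq _ _ _ (leq_maxr N1 N2) N2w.
set N := maxn N1 N2 in Nv Nw.
have nN : n + N%:Z < (`|n|.+1 + N)%N%:Z by lia.
rewrite (E_def _ _ _ _ (bnd_lin _ a _ _ Nv Nw) nN).
rewrite (E_def _ _ _ _ Nv nN) (E_def _ _ _ _ Nw nN).
rewrite scaler_sumr -big_split /=; apply: eq_bigr => i _.
by rewrite linearP mulrDr scalerAr.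
Qed.

(** Moves the shift onto [c], so that all terms of [T_E] are sums over one range with the same T (n
    - i) and can be compared termwise. *)
Lemma E_shift N (M s : nat) n v : bnd N v -> n + N%:Z < M%:Z ->
  E (n - s%:Z) v = \sum_(i < M) c (i%:Z - s%:Z) * T (n - i%:Z) v.
Proof.
move=> Nv; elim: s n M => [|s IHs] n M nM.
  rewrite subr0 (E_def _ _ _ _ Nv nM).
  by apply: eq_bigr => i _; rewrite subr0.
case: M nM => [|M] nM; first by rewrite (E_def _ 0 _ _ Nv) ?big_ord0 //; lia.
rewrite big_ord_recl c_neg ?mul0r ?add0r; last by lia.
rewrite (_ : n - s.+1%:Z = n - 1 - s%:Z); last by lia.
rewrite (IHs _ M); last by lia.
by apply: eq_bigr => i _; congr (c _ * T _ v); rewrite lift0; lia.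
Qed.

Lemma T_E n m v :
  T n (E m v) = E m (T n v) - E (m - 1) (T (n + 1) v)
                - E (m - 1) (T (n - 1) v) + E (m - 2) (T n v).
Proof.
have [N Nv] := bnd_ex v.
have mM : m + N%:Z < (`|m| + N).+1%:Z by lia.
rewrite (E_def _ _ _ _ Nv mM) linear_sum.
rewrite (E_def _ _ _ _ (bnd_T _ n _ Nv) mM).
rewrite (E_shift _ _ 1 _ _ (bnd_T _ (n + 1) _ Nv) mM).
rewrite (E_shift _ _ 1 _ _ (bnd_T _ (n - 1) _ Nv) mM).
rewrite (E_shift _ _ 2 _ _ (bnd_T _ n _ Nv) mM).
rewrite -!sumrN -!big_split; apply: eq_bigr => i _ /=.
by rewrite T_c !(TC (m - i%:Z)).
Qed.

(* z E(z) E(w) = (z - w)(1 - zw) :E(z) E(w): is antisymmetric in z and w. *)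
Lemma E_anti n m v : E n (E m v) = - E (m - 1) (E (n + 1) v).
Proof.
have [N0 N0v] := bnd_ex v.
have [N1 N1v] := bnd_ex (E m v); have [N2 N2v] := bnd_ex (E (n + 1) v).
pose N := maxn N0 (maxn N1 N2).
have Nv : bnd N v by apply: bnd_leq N0v; rewrite /N; lia.
have Nmv : bnd N (E m v) by apply: bnd_leq N1v; rewrite /N; lia.
have Nnv : bnd N (E (n + 1) v) by apply: bnd_leq N2v; rewrite /N; lia.
pose M := (`|n| + `|m| + N).+3.
(* [D p q] is the coefficient of z^p w^q in c(z) E(w) T(z) v, which equals c(z) c(w) T(w) T(z) v and
   so is symmetric ([DC]). *)
pose D p q := \sum_(i < M) c i * E q (T (p - i%:Z) v).
have DC p q : p + N%:Z < M%:Z -> q + N%:Z < M%:Z -> D p q = D q p.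
  move=> pM qM.
  have DE p' q' : q' + N%:Z < M%:Z -> D p' q' = \sum_(i < M) \sum_(j < M)
      c i * (c j * T (q' - j%:Z) (T (p' - i%:Z) v)).
    move=> qM'; apply: eq_bigr => i _.
    by rewrite (E_def _ _ _ _ (bnd_T _ _ _ Nv) qM') mulr_sumr.
  rewrite !DE // exchange_big; apply: eq_bigr => i _; apply: eq_bigr => j _.
  by rewrite mulrCA TC.
(* Passing T(z) over E(w) turns E(z) E(w) into (1 - w/z)(1 - wz) times the series of [D]. *)
have EED p q : p + N%:Z < M%:Z -> bnd N (E q v) ->
    E p (E q v) = D p q - D (p + 1) (q - 1) - D (p - 1) (q - 1) + D p (q - 2).
  move=> pM Nqv; rewrite (E_def _ _ _ _ Nqv pM) /D -!sumrN -!big_split.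
  apply: eq_bigr => i _ /=; rewrite T_E mulrDr !mulrBr.
  rewrite (_ : p + 1 - i%:Z = p - i%:Z + 1); last by lia.
  by rewrite (_ : p - 1 - i%:Z = p - i%:Z - 1); last by lia.
rewrite !EED ?[_ + 1 - 1]addrK //; try by rewrite /M; lia.
rewrite (_ : m - 1 + 1 = m); last by lia.
rewrite (_ : m - 1 - 1 = m - 2); last by lia.
rewrite (_ : n + 1 - 2 = n - 1); last by lia.
rewrite (DC (m - 1) (n + 1)) 1?(DC m n) 1?(DC (m - 2) n) 1?(DC (m - 1) (n - 1));
  try by rewrite /M; lia.
ring.
Qed.

Context (d : nat) (phi : {scalar V}).
Context (phi_1 : phi 1 = 1) (phi_x : forall j v, phi (x j * v) = 0).

(** By [c_rec], a nonzero multiple of [c p.+1] lies in the ideal generated by the x_j, which [phi]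
    kills. *)
Lemma phi_c p v : phi (c p.+1%:Z * v) = 0.
Proof.
apply: (mulfI (natr_neq0 p)); rewrite mulr0 -linearZ /= scalerAl c_rec mulNr.
rewrite mulr_suml linearN linear_sum big1 ?oppr0 // => j _.
by rewrite -mulrA phi_x.
Qed.

(* The coefficients of (1 - z^d) E(z), except that X = E when d = 0. *)
Definition X n v : V := E n v - (0 < d)%N%:R *: E (n - d%:Z) v.

Lemma X_linear n : linear (X n).
Proof.
move=> a v w; rewrite /X !E_linear !(scalerDr, scalerN) opprD addrACA.
by rewrite !scalerA [_%:R * a]mulrC.
Qed.

HB.instance Definition _ n :=
  GRing.isLinear.Build F V V *:%R (X n) (X_linear n).

(** For d > 0 the extra factor (1 - z^d)(1 - w^d) is symmetric in z and w; for d = 0 there is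
    none. *)
Lemma X_anti n m v : X n (X m v) = - X (m - 1) (X (n + 1) v).
Proof.
have EB p q v1 v2 (s : F) :
    E p (E q v1 - s *: v2) = E p (E q v1) - s *: E p v2.
  by rewrite addrC -scaleNr E_linear scaleNr addrC.
rewrite /X !EB !scalerBr.
rewrite ![E n (E _ _)]E_anti ![E (n - _) (E _ _)]E_anti.
rewrite (_ : m - d%:Z - 1 = m - 1 - d%:Z); last by lia.
rewrite (_ : n - d%:Z + 1 = n + 1 - d%:Z); last by lia.
by rewrite !scalerN; ring.
Qed.

Lemma phi_E n v : phi (E n v) = phi (T n v).
Proof.
have [N Nv] := bnd_ex v.
have nM : n + N%:Z < (`|n| + N).+1%:Z by lia.
rewrite (E_def _ _ _ _ Nv nM) big_ord_recl c_0 mul1r subr0 linearD linear_sum.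
by rewrite big1 ?addr0 // => i _; exact: phi_c.
Qed.

(** For d > 0, [phi] turns X(z) into (1 - z^d) T(z), where T(1/z) = T(z) and 1 - z^(-d) = - z^(-d)
    (1 - z^d). For d = 0 only the symmetry of T remains. *)
Lemma phi_X_reflect n v :
  phi (X (d%:Z - n) v) = (-1) ^+ (0 < d)%N * phi (X n v).
Proof.
rewrite /X !linearB !linearZ /= !phi_E.
rewrite -[T (d%:Z - n) v]T_opp -[T (d%:Z - n - d%:Z) v]T_opp opprB.
rewrite (_ : - (d%:Z - n - d%:Z) = n); last by lia.
by case: d => [|d'] /=; rewrite ?mulr0n ?mulr1n ?mul0r ?subr0 ?subr0; ring.
Qed.

Lemma E_vac n : E n 1 = c n.
Proof.
have [N N1] := bnd_ex 1.
have nM : n + N%:Z < (`|n| + N).+1%:Z by lia.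
rewrite (E_def _ _ _ _ N1 nM).
have [n0|n0] := ltP n 0.
  rewrite c_neg // big1 // => i _; rewrite T_1 ifF ?mulr0 //; lia.
have nN : (`|n| < (`|n| + N).+1)%N by lia.
rewrite (bigD1 (Ordinal nN)) //= T_1 ifT; last by lia.
rewrite mulr1 big1 ?addr0 => [|i]; first by congr c; lia.
by rewrite -val_eqE /= => ni; rewrite T_1 ifF ?mulr0 //; lia.
Qed.

Lemma X_vac_neg n : n < 0 -> X n 1 = 0.
Proof. by move=> n0; rewrite /X !E_vac !c_neg ?scaler0 ?subr0 //; lia. Qed.

Lemma X_vac_0 : X 0 1 = 1.
Proof.
rewrite /X !E_vac c_0; case: d => [|d']; first by rewrite scale0r subr0.
by rewrite c_neg ?scaler0 ?subr0.
Qed.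

Definition ketz (l : seq int) : V := foldr X 1 l.

Lemma phi_ketz_partition s : (d <= 2)%N -> sorted geq s ->
  phi (ketz [seq i%:Z | i <- s]) =
    if frob_shift d s then (-1) ^+ frob_sign d s else 0.
Proof.
move=> d2 ss.
apply: (Phi_partition (natr_neq0 1) d d2 (fun l => phi (ketz l))) => //.
- move=> p q n m; rewrite -linearN; congr (phi _).
  elim: p => [|y p IHp] /=; first exact: X_anti.
  by rewrite IHp linearN.
- by move=> n q; exact: phi_X_reflect.
- move=> p n n0; rewrite /ketz foldr_rcons X_vac_neg //.
  have -> : foldr X 0 p = 0 by elim: p => //= y p ->; exact: linear0.
  exact: linear0.
- by move=> p; rewrite /ketz foldr_rcons X_vac_0.
Qed.

End VertexOperators.

(** * Operators on the Fock space *)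

Section FockOperators.
Context {F : fieldType}.
Implicit Types (v w : fock F) (m : {cmonom nat}) (n i : int) (N k j : nat).

Lemma annihilate_linear j : linear (@annihilate F j).
Proof.
move=> c v w; apply/malgP => m.
by rewrite !(mcoeffD, mcoeffZ, mcoeff_annihilate) mulrDr mulrCA.
Qed.

HB.instance Definition _ j :=
  GRing.isLinear.Build F (fock F) (fock F) *:%R (@annihilate F j)
    (annihilate_linear j).

Lemma create_linear j : linear (@create F j).
Proof. by move=> c v w; rewrite create.unlock mulrDr scalerAr. Qed.

HB.instance Definition _ j :=
  GRing.isLinear.Build F (fock F) (fock F) *:%R (@create F j)
    (create_linear j).

Lemma annihilation_part_linear n : linear (@annihilation_part F n).
Proof.
move=> c v w; rewrite /annihilation_part.
case: eqP => [_|]; first by rewrite scaler0 addr0.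
case: n => [[|j]|j] //= _; rewrite /a /= linearP scalerDr !scalerA;
  by rewrite (mulrC _ c).
Qed.

HB.instance Definition _ n :=
  GRing.isLinear.Build F (fock F) (fock F) *:%R (@annihilation_part F n)
    (annihilation_part_linear n).

Definition bounded N v := forall m, (N < wdeg m)%N -> v@_m = 0.

Lemma bounded_leq N1 N2 v : (N1 <= N2)%N -> bounded N1 v -> bounded N2 v.
Proof. by move=> N12 Nv m lt; apply: Nv; apply: leq_ltn_trans lt. Qed.

Lemma boundedP v : exists N, bounded N v.
Proof.
exists (\max_(m <- msupp v) wdeg m)%N => m; apply: contraTeq.
rewrite mcoeff_neq0 -leqNgt => mv.
exact: (@leq_bigmax_seq _ (enum_fset (msupp v)) xpredT wdeg).
Qed.

Lemma bounded_create N j v : bounded N v -> bounded (N + j.+1) (create j v).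
Proof.
move=> Nv m; rewrite mcoeff_create; case: ifP => // mj ltN.
apply: Nv; have mE : m = mmul (divcm m (ucm j)) (ucm j).
  apply/eqP/cmP => i; rewrite cmM divcmE cmU.
  by case: eqP => [<-|_]; rewrite ?subnK // subn0 addn0.
by move: ltN; rewrite {1}mE wdegM wdegU ltn_add2r.
Qed.

Lemma boundedD N v w : bounded N v -> bounded N w -> bounded N (v + w).
Proof. by move=> Nv Nw m lt; rewrite mcoeffD Nv ?Nw ?addr0. Qed.

Lemma boundedZ N c v : bounded N v -> bounded N (c *: v).
Proof. by move=> Nv m lt; rewrite mcoeffZ Nv ?mulr0. Qed.

Lemma bounded_vacuum : bounded 0 (vacuum F).
Proof.
move=> m; rewrite mcoeff1; case: eqP => // ->.
by rewrite /wdeg mdom1 big_seq_fset0.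
Qed.

Lemma mcoeff_annihilation_part n v m :
  (annihilation_part n v)@_m =
    if n == 0 then 0 else
    `|n|%:~R^-1 * ((`|n| * (m `|n|.-1).+1)%N%:R *
                   v@_(mmul m (ucm `|n|.-1)%N)).
Proof.
rewrite /annihilation_part; case: eqP => [|]; first by rewrite mcoeff0.
case: n => [[|j]|j] //= _; rewrite mcoeffZ.
  by rewrite mcoeff_annihilate.
by rewrite mcoeff_annihilate.
Qed.

Definition annpow k : distrib F := dist_pow (@annihilation_part F) k.

Lemma annpow0 n v : annpow 0 n v = if n == 0 then v else 0.
Proof. by []. Qed.

(** A factor with exponent i lowers the degree by |i| >= 1, so k factors with total exponent n lower
    it by at least k and at least |n|. *)
Lemma mcoeff_annpow0 N k n v m : bounded N v ->
  (N < wdeg m + k)%N || (N < wdeg m + `|n|)%N -> (annpow k n v)@_m = 0.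
Proof.
move=> Nv; elim: k n m => [|k IHk] n m.
  rewrite /annpow /= /dist1 addn0; case: eqP => [->|_] H; last exact: mcoeff0.
  by apply: Nv; move: H; rewrite addn0 orbb.
move=> H; rewrite /annpow /= /dist_mul raddf_sum big1 // => i _ /=.
rewrite mcoeff_annihilation_part; case: eqP => // i0.
by rewrite IHk ?mulr0 // wdegM wdegU; lia.
Qed.

Lemma annpow_eq0 N k n v : bounded N v ->
  (N < k)%N || (N < `|n|)%N -> annpow k n v = 0.
Proof.
move=> Nv H; apply/malgP => m; rewrite mcoeff0.
by apply: mcoeff_annpow0 Nv _; lia.
Qed.

Lemma bounded_annpow N k n v : bounded N v -> bounded N (annpow k n v).
Proof. by move=> Nv m lt; apply: mcoeff_annpow0 Nv _; lia. Qed.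

Lemma annpowS N k n v : bounded N v ->
  annpow k.+1 n v =
    \sum_(i <- zrange N) annihilation_part i (annpow k (n - i) v).
Proof.
move=> Nv; rewrite /annpow /= /dist_mul; apply: fsum_int => i iN.
apply/malgP => m; rewrite mcoeff0 mcoeff_annihilation_part.
case: eqP => // _; rewrite [_@_(mmul _ _)](bounded_annpow _ _ _ _ Nv) ?mulr0 //.
by rewrite wdegM wdegU; lia.
Qed.

Lemma annpow_linear k n : linear (annpow k n).
Proof.
move=> c v w; elim: k n => [|k IHk] n.
  by rewrite /annpow /= /dist1; case: eqP => // _; rewrite scaler0 addr0.
have [N1 N1v] := boundedP v; have [N2 N2w] := boundedP w.
have Nv := bounded_leq _ _ _ (leq_maxl N1 N2) N1v.
have Nw := bounded_leq _ _ _ (leq_maxr N1 N2) N2w.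
rewrite !(annpowS (maxn N1 N2)) //; last by apply/boundedD/Nw/boundedZ.
rewrite scaler_sumr -big_split /=; apply: eq_bigr => i _.
by rewrite IHk linearP.
Qed.

HB.instance Definition _ k n :=
  GRing.isLinear.Build F (fock F) (fock F) *:%R (annpow k n)
    (annpow_linear k n).

Definition annexp : distrib F := dist_exp (@annihilation_part F).

Lemma annexpE N K n v : bounded N v -> (N < K)%N ->
  annexp n v = \sum_(k < K) k`!%:R^-1 *: annpow k n v.
Proof.
move=> Nv NK; apply: fsum_nat => k Kk.
by rewrite -/(annpow k) (annpow_eq0 _ _ _ _ Nv) ?scaler0 //; lia.
Qed.

Lemma annexp_linear n : linear (annexp n).
Proof.
move=> c v w.
have [N1 N1v] := boundedP v; have [N2 N2w] := boundedP w.
have Nv := bounded_leq _ _ _ (leq_maxl N1 N2) N1v.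
have Nw := bounded_leq _ _ _ (leq_maxr N1 N2) N2w.
rewrite !(annexpE (maxn N1 N2) _ _ _ _ (ltnSn _)) //; last first.
  by apply/boundedD/Nw/boundedZ.
rewrite scaler_sumr -big_split /=; apply: eq_bigr => k _.
by rewrite linearP scalerDr !scalerA mulrC.
Qed.

HB.instance Definition _ n :=
  GRing.isLinear.Build F (fock F) (fock F) *:%R (annexp n)
    (annexp_linear n).

Lemma annexp_eq0 N n v : bounded N v -> (N < `|n|)%N -> annexp n v = 0.
Proof.
move=> Nv Nn; rewrite (annexpE _ _ _ _ Nv (ltnSn N)) big1 // => k _.
by rewrite (annpow_eq0 _ _ _ _ Nv) ?scaler0 // Nn orbT.
Qed.

Lemma bounded_annexp N n v : bounded N v -> bounded N (annexp n v).
Proof.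
move=> Nv m lt; rewrite (annexpE _ _ _ _ Nv (ltnSn N)).
rewrite raddf_sum big1 //= => k _.
by rewrite mcoeffZ (bounded_annpow _ _ _ _ Nv) ?mulr0.
Qed.

Lemma annexp_vacuum n : annexp n (vacuum F) = if n == 0 then vacuum F else 0.
Proof.
rewrite (annexpE _ _ _ _ bounded_vacuum (ltnSn 0)) big_ord1 /= invr1 scale1r.
exact: annpow0.
Qed.

Context (char0 : [pchar F] =i pred0).

Lemma natr_neq0 k : k.+1%:R != 0 :> F.
Proof. by have /pcharf0P -> := char0. Qed.

Lemma annihilation_part_create i j v :
  annihilation_part i (create j v) =
    create j (annihilation_part i v) + (if `|i|%N == j.+1 then v else 0).
Proof.
rewrite /annihilation_part; case: (eqVneq i 0) => [->|i0].
  by rewrite linear0 addr0.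
have ni0 : `|i| != 0 by rewrite normr_eq0.
have /eqP := @heisenberg F `|i| (Negz j) v ni0 isT.
rewrite subr_eq => /eqP H.
rewrite [a _ (create j v)]H scalerDr addrC; congr (_ + _).
  by rewrite [in RHS]linearZ.
rewrite NegzE opprK; case: (eqVneq `|i|%N j.+1) => ij.
  have -> : `|i| = j.+1%:Z by lia.
  by rewrite eqxx scalerA mulVf ?scale1r // natr_neq0.
by case: eqP => [|_]; [lia | rewrite scaler0].
Qed.

Lemma annexp_create n j v :
  annexp n (create j v) = create j (annexp n v) +
    (annexp (n - j.+1%:Z) v + annexp (n + j.+1%:Z) v).
Proof.
have [N Nv] := boundedP v.
have Nc := bounded_create _ j _ Nv.
have NN := bounded_leq _ _ _ (leq_addr j.+1 N) Nv.
have NK : (N < N + j.+1)%N by rewrite addnS ltnS leq_addr.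
(* [create j v] has degree at most N + j + 1. The cutoffs N + j + 2 and N + j + 1 are both large
   enough and differ by one, as in [exp_commutator]. *)
rewrite (annexpE _ _ n _ Nc (ltnSn _)) (annexpE _ _ n _ NN (ltnSn _)).
rewrite (annexpE _ _ (n - _) _ Nv NK) (annexpE _ _ (n + _) _ Nv NK).
have jM : (j < N + j.+1)%N by lia.
apply: (exp_commutator (fun i => @annihilation_part F i) annpow (@create F j)
  j (N + j.+1) v jM).
- exact: annpow0.
- by move=> w k n' [->|->]; exact: annpowS.
- by move=> i w; exact: annihilation_part_create.
- exact: natr_neq0.
Qed.

Lemma malgU_scale (c : F) m : << c *g m >> = c *: << m >> :> fock F.
Proof.
apply/malgP => k; rewrite [RHS]mcoeffZ [LHS]mcoeffU mcoeffU1.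
by rewrite mulr_natr.
Qed.

Lemma cmonom_ind (P : {cmonom nat} -> Prop) :
  P mone -> (forall j m, P m -> P (mmul (ucm j) m)) -> forall m, P m.
Proof.
move=> P1 PU m; have [d md] : exists d, (mdeg m < d)%N by exists (mdeg m).+1.
elim: d m md => [//|d IHd] m md.
have [->|m1] := eqVneq m mone; first exact: P1.
have [j mj] : exists j, (0 < m j)%N.
  apply/notP => H; case/eqP: m1; apply/eqP/cmP => j; rewrite cm1.
  by apply/eqP; rewrite -leqn0 leqNgt; apply/negP => mj; apply: H; exists j.
have mE : m = mmul (ucm j) (divcm m (ucm j)).
  apply/eqP/cmP => i; rewrite cmM divcmE cmU.
  by case: eqP => [<-|_]; rewrite ?subnKC // subn0.
by rewrite mE; apply/PU/IHd; move: md; rewrite {1}mE mdegM mdegU.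
Qed.

Lemma create_cmonom j m : create j << m >> = << mmul (ucm j) m >> :> fock F.
Proof. by rewrite create.unlock malgM_def fgmulUU mulr1. Qed.

(** The vacuum is cyclic for the creation operators. *)
Lemma fock_ind (P : fock F -> Prop) :
  P (vacuum F) -> (forall c v w, P v -> P w -> P (c *: v + w)) ->
  (forall j v, P v -> P (create j v)) -> forall v, P v.
Proof.
move=> P1 PD Pc v.
have P0 : P 0 by rewrite -(addNr (vacuum F)) -scaleN1r; apply: PD.
have PU m : P << m >>.
  elim/cmonom_ind: m => [|j m Pm]; first exact: P1.
  by rewrite -create_cmonom; exact: Pc.
rewrite [v]monalgE; elim: (enum_fset (msupp v)) => [|m s IHs].
  by rewrite big_nil.
rewrite big_cons malgU_scale; exact: PD (PU m) IHs.
Qed.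

(** Its value on the vacuum determines the creation exponential, which acts by multiplication
    ([cexp_mul]). *)
Definition cexp n : fock F := dist_exp (@creation_part F) n (vacuum F).

Let var j : fock F := << ucm j >>.

Lemma createE j v : create j v = var j * v.
Proof. by rewrite create.unlock. Qed.

Lemma creation_part_def n v :
  creation_part n v =
    if 0 < n then - (n%:~R^-1 *: (var `|n|.-1%N * v)) else 0.
Proof.
rewrite /creation_part; case: n => [[|p]|p]; [exact: erefl| |exact: erefl].
by rewrite -createE; exact: erefl.
Qed.

Lemma cexp_mul n v : dist_exp (@creation_part F) n v = cexp n * v.
Proof.
exact: (creation_exp_mul var (@creation_part F)
  (fun k => dist_pow (@creation_part F) k) creation_part_def).
Qed.

Lemma cexp_neg n : n < 0 -> cexp n = 0.
Proof.
exact: (creation_exp_neg var (@creation_part F)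
  (fun k => dist_pow (@creation_part F) k) creation_part_def).
Qed.

Lemma cexp_0 : cexp 0 = 1.
Proof.
exact: (creation_exp0 var (@creation_part F)
  (fun k => dist_pow (@creation_part F) k) creation_part_def).
Qed.

Lemma cexp_rec (p : nat) :
  p.+1%:R *: cexp p.+1 = - \sum_(j < p.+1) var j * cexp (p%:Z - j%:Z).
Proof.
exact: (creation_exp_rec natr_neq0 var (@creation_part F)
  (fun k => dist_pow (@creation_part F) k) creation_part_def).
Qed.

Lemma EstarE N M n v : bounded N v -> n + N%:Z < M%:Z ->
  Estar n v = \sum_(i < M) cexp i * annexp (n - i%:Z) v.
Proof.
move=> Nv nM; rewrite /Estar /dist_mul.
rewrite (fsum_setTE _ _ [seq k%:Z | k <- iota 0 M]).
- rewrite big_map.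
  rewrite -(big_mkord xpredT (fun k => cexp k%:Z * annexp (n - k%:Z) v)).
  by rewrite /index_iota subn0; apply: eq_bigr => i _; rewrite cexp_mul.
- by rewrite map_inj_uniq ?iota_uniq // => i j [].
(* Outside 0 <= i < M either i < 0, where [cexp] vanishes, or n - i < -N, where the annihilation
   exponential kills v. *)
move=> i iM; rewrite cexp_mul; have [i0|i0] := ltP i 0.
  by rewrite cexp_neg ?mul0r.
rewrite -[dist_exp _ _ _]/(annexp (n - i) v) (annexp_eq0 _ _ _ Nv) ?mulr0 //.
suff : (M <= `|i|)%N by lia.
rewrite leqNgt; apply: contra iM => iM.
by apply/mapP; exists (`|i|%N); rewrite ?mem_iota; lia.
Qed.

Lemma vac_coef_linear : scalar (@vac_coef F).
Proof. by move=> c v w; rewrite /vac_coef mcoeffD mcoeffZ. Qed.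

HB.instance Definition _ :=
  GRing.isLinear.Build F (fock F) F *%R (@vac_coef F) vac_coef_linear.

Lemma vac_coef_var j v : vac_coef (var j * v) = 0.
Proof. by rewrite -createE; exact: (@vac_coef_create F (Negz j) v isT). Qed.

Lemma annexp_var n j v :
  annexp n (var j * v) = var j * annexp n v +
    (annexp (n - j.+1%:Z) v + annexp (n + j.+1%:Z) v).
Proof. by rewrite -!createE annexp_create. Qed.

Lemma var_ind (P : fock F -> Prop) : P 1 ->
  (forall c v w, P v -> P w -> P (c *: v + w)) ->
  (forall j v, P v -> P (var j * v)) -> forall v, P v.
Proof.
by move=> P1 PD PX; apply: fock_ind => // j v Pv; rewrite createE; exact: PX.
Qed.

Lemma bounded_linear N c v w :
  bounded N v -> bounded N w -> bounded N (c *: v + w).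
Proof. by move=> Nv Nw; apply: boundedD => //; exact: boundedZ. Qed.

Lemma vac_coef_ket d s : (d <= 2)%N -> is_partition s ->
  vac_coef (ket (X (@Estar F) d) s) =
    if frob_shift d s then (-1) ^+ frob_sign d s else 0.
Proof.
move=> d2 ss.
have -> : ket (X (@Estar F) d) s = ketz (@Estar F) d [seq k%:Z | k <- s].
  by rewrite /ketz foldr_map.
exact: (phi_ketz_partition natr_neq0 var annexp annexp_vacuum annexp_var var_ind
  cexp cexp_neg cexp_0 cexp_rec bounded bounded_leq boundedP bounded_linear
  bounded_annexp (@Estar F) EstarE d (@vac_coef F) (@vac_coef_vacuum F)
  vac_coef_var).
Qed.
End FockOperators.

(** * The three cases d = 1, 2, 0 *)

Lemma eq_ket (F : fieldType) (X Y : distrib F) s :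
  (forall n v, X n v = Y n v) -> ket X s = ket Y s.
Proof. by move=> XY; rewrite /ket; elim: s => //= n s ->; exact: XY. Qed.

Lemma frob_shift1P s : sorted geq s -> reflect (frob_eq s) (frob_shift 1 s).
Proof.
move=> ss; apply: (iffP eqP) => [|[al [_ sE]]]; last by rewrite sE.
move=> /(inj_map succn_inj) E; exists (frobenius s).1.
by rewrite sorted_frobenius1 // {1}[frobenius s]surjective_pairing -E.
Qed.

Lemma frob_shift2P s :
  sorted geq s -> reflect (frob_arm_succ s) (frob_shift 2 s).
Proof.
move=> ss; apply: (iffP eqP) => [|[al [_ sE]]]; last by rewrite sE -map_comp.
have -> : map (addn 2) (frobenius s).2 = map succn (map succn (frobenius s).2).
  by rewrite -map_comp.
move=> /(inj_map succn_inj) E; exists (frobenius s).2.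
rewrite {2}[frobenius s]surjective_pairing E; split => //.
by have := sorted_frobenius1 _ ss; rewrite E sorted_map.
Qed.

Lemma frob_shift0P s :
  sorted geq s -> reflect (frob_leg_succ s) (frob_shift 0 s).
Proof.
move=> ss; apply: (iffP eqP) => [|[al [_ sE]]]; last first.
  by rewrite sE /= map_id.
rewrite (_ : map (addn 0) _ = (frobenius s).2); last exact: map_id.
move=> E; exists (frobenius s).1.
by rewrite sorted_frobenius1 // {1}[frobenius s]surjective_pairing -E.
Qed.

Theorem lemma3p1 (F : fieldType) (char0 : [pchar F] =i pred0)
    (lam : seq nat) (lam_part : is_partition lam) :
  [/\ vac_coef (ket_so F lam) =
        (if `[< frob_eq lam >] then (-1) ^+ ((weight lam + rk lam)./2) else 0),
      vac_coef (ket_sp F lam) =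
        (if `[< frob_arm_succ lam >] then (-1) ^+ ((weight lam)./2) else 0)
    & vac_coef (ket_o F lam) =
        (if `[< frob_leg_succ lam >] then (-1) ^+ ((weight lam)./2) else 0)].
Proof.
split.
- rewrite [ket_so F lam](eq_ket F _ (X (@Estar F) 1)) => [|n v]; last first.
    by rewrite /X scale1r.
  rewrite vac_coef_ket //.
  rewrite (asbool_equiv_eqP (frob_shift1P _ lam_part) (iff_refl _)).
  case: ifP => // lamE; rewrite (weight_frob_shift _ _ lam_part lamE).
  by rewrite /frob_sign; congr (_ ^+ _); lia.
- rewrite [ket_sp F lam](eq_ket F _ (X (@Estar F) 2)) => [|n v]; last first.
    by rewrite /X scale1r.
  rewrite vac_coef_ket //.
  rewrite (asbool_equiv_eqP (frob_shift2P _ lam_part) (iff_refl _)).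
  case: ifP => // lamE; rewrite (weight_frob_shift _ _ lam_part lamE).
  by rewrite /frob_sign; congr (_ ^+ _); lia.
- rewrite [ket_o F lam](eq_ket F _ (X (@Estar F) 0)) => [|n v]; last first.
    by rewrite /X scale0r subr0.
  rewrite vac_coef_ket //.
  rewrite (asbool_equiv_eqP (frob_shift0P _ lam_part) (iff_refl _)).
  case: ifP => // lamE; rewrite (weight_frob_shift _ _ lam_part lamE).
  by rewrite /frob_sign; congr (_ ^+ _); lia.
Qed.
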